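(* Every pseudomodular matroid has the $k$-fold circuit property for all $k\geq 1$.
   Context: Matroids have finite ground sets. For $\mathcal{M}=(E,r)$ with closure $\mathrm{cl}(X)=\{x: r(X+x)=r(X)\}$, the flats are the sets $F$ with $\mathrm{cl}(F)=F$; the lattice of flats is ordered by inclusion, with $X\wedge Y=X\cap Y$, $X\vee Y=\mathrm{cl}(X\cup Y)$, and grading $r$. A geometric lattice is a graded, atomistic, semimodular lattice. For a lattice $\mathcal{L}$, a function $r:\mathcal{L}\to\mathbb{Z}$ is pseudomodular if for all $X,Y,Z\in\mathcal{L}$ with $r(X\vee Z)-r(X)=r(Y\vee Z)-r(Y)=r(X\vee Y\vee Z)-r(X\vee Y)$ one has $r((X\vee Z)\wedge(Y\vee Z))-r(X\wedge Y)=r(X\vee Z)-r(X)$. A lattice is pseudomodular if it is geometric and its grading is pseudomodular; a matroid is pseudomodular if its lattice of flats is pseudomodular. A cyclic set is a set $D$ with $r(D-e)=r(D)$ for all $e\in D$; a $k$-fold circuit is a cyclic set with $r(D)=|D|-k$; its principal partition is $\{D\setminus B: B\subseteq D\text{ a }(k-1)\text{-fold circuit}\}$. A $k$-fold circuit $D$ with principal partition $\{A_1,\dots,A_\ell\}$ is balanced if $r(\bigcap_{i=1}^\ell\mathrm{cl}(D\setminus A_i))=\ell-k$, and $\mathcal{M}$ has the $k$-fold circuit property if all its $k$-fold circuits are balanced. *)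

(* Defs.v *)
From HB Require Import structures.
From mathcomp Require Import all_boot all_order all_algebra.
From mathcomp Require Import zify.

Set Implicit Arguments.
Unset Strict Implicit.
Unset Printing Implicit Defensive.

Import Order.TTheory GRing.Theory Num.Theory.

Local Open Scope order_scope.

Section Lattices.
Context {d : Order.disp_t}.

Definition covered (L : finTBLatticeType d) (x y : L) : bool :=
  (x < y) && [forall z : L, ~~ ((x < z) && (z < y))].

Definition atom (L : finTBLatticeType d) (a : L) : bool := covered \bot a.

(* In a finite lattice a grading is unique when it exists (grading_unique),
   so "the grading" of a graded lattice is meaningful below. *)
Definition is_grading (L : finTBLatticeType d) (rho : L -> nat) : Prop :=
  rho \bot = 0 /\ (forall x y : L, covered x y -> rho y = (rho x).+1).

Definition graded (L : finTBLatticeType d) : Prop :=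
  exists rho : L -> nat, is_grading rho.

Definition atomistic (L : finTBLatticeType d) : Prop :=
  forall x : L, exists2 A : {set L},
    (forall a, a \in A -> atom a) & x = \join_(a in A) a.

Definition semimodular (L : finTBLatticeType d) : Prop :=
  exists2 rho : L -> nat, is_grading rho &
    forall x y : L, (rho (x `|` y) + rho (x `&` y) <= rho x + rho y)%N.

Definition geometric (L : finTBLatticeType d) : Prop :=
  [/\ graded L, atomistic L & semimodular L].

Definition pseudomodular_fun (L : latticeType d) (r : L -> int) : Prop :=
  forall X Y Z : L,
    (r (X `|` Z) - r X = r (Y `|` Z) - r Y)%R ->
    (r (Y `|` Z) - r Y = r (X `|` Y `|` Z) - r (X `|` Y))%R ->
    (r ((X `|` Z) `&` (Y `|` Z)) - r (X `&` Y) = r (X `|` Z) - r X)%R.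

Definition pseudomodular_lattice (L : finTBLatticeType d) : Prop :=
  geometric L /\
  (exists2 rho : L -> nat, is_grading rho &
     pseudomodular_fun (fun x => (rho x)%:Z%R)).

Lemma grading_unique (L : finTBLatticeType d) (rho sigma : L -> nat) :
  is_grading rho -> is_grading sigma -> rho =1 sigma.
Proof.
move=> [r0 rS] [s0 sS] x.
have [n] := ubnP #|[set y | y < x]|; elim: n x => // n IH x lt_n.
have [->|x_neq0] := eqVneq x \bot; first by rewrite r0 s0.
have bx : \bot < x by rewrite lt0x.
have [y yx ymax] := @arg_maxnP L \bot (fun y => y < x) (fun y => #|[set z | z < y]|) bx.
have cyx : covered y x.
  rewrite /covered yx /=; apply/forallP => z; apply/negP => /andP[yz zx].
  have := ymax z zx; rewrite /= leqNgt => /negP; apply.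
  apply: proper_card; apply/properP; split.
    by apply/subsetP => w; rewrite !inE => /lt_trans; apply.
  by exists y; rewrite !inE ?ltxx.
rewrite (rS _ _ cyx) (sS _ _ cyx) IH //.
suff /proper_card lt_yx : [set z | z < y] \proper [set z | z < x].
  exact: leq_trans lt_yx lt_n.
apply/properP; split.
  by apply/subsetP => w; rewrite !inE => /lt_trans; apply.
by exists y; rewrite !inE ?ltxx.
Qed.

End Lattices.

Local Close Scope order_scope.

Record matroid (E : finType) := Matroid {
  rank :> {set E} -> nat;
  rank_le_card : forall X, rank X <= #|X|;
  rank_mono : forall X Y : {set E}, X \subset Y -> rank X <= rank Y;
  rank_submod : forall X Y, rank (X :|: Y) + rank (X :&: Y) <= rank X + rank Y
}.

Section Flats.
Variables (E : finType) (M : matroid E).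
Implicit Types X Y : {set E}.

Definition cl X : {set E} := [set x | rank M (x |: X) == rank M X].

Definition is_flat X : bool := cl X == X.

Lemma sub_cl X : X \subset cl X.
Proof. by apply/subsetP => x xX; rewrite inE (setUidPr _) // sub1set. Qed.

Lemma clS X Y : X \subset Y -> cl X \subset cl Y.
Proof.
move=> sXY; apply/subsetP => x; rewrite !inE => /eqP rx.
have := rank_submod M (x |: X) Y.
rewrite -setUA (setUidPr sXY) rx => h.
have := rank_mono M (subsetUr [set x] Y).
have : rank M X <= rank M ((x |: X) :&: Y).
  by apply: rank_mono; rewrite subsetI sXY subsetUr.
lia.
Qed.

Lemma rank_setU_cl X Y : Y \subset cl X -> rank M (X :|: Y) = rank M X.
Proof.
have [n] := ubnP #|Y|; elim: n Y => // n IH Y ltn sY.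
have [->|[y yY]] := set_0Vmem Y; first by rewrite setU0.
have IHy : rank M (X :|: (Y :\ y)) = rank M X.
  apply: IH; last by rewrite (subset_trans _ sY) ?subsetDl.
  by move: ltn; rewrite (cardsD1 y) yY.
have ycl : y \in cl (X :|: (Y :\ y)).
  by apply: (subsetP (clS (subsetUl X (Y :\ y)))); apply: (subsetP sY).
move: ycl; rewrite inE IHy => /eqP <-.
by rewrite setUCA setD1K.
Qed.

Lemma rank_cl X : rank M (cl X) = rank M X.
Proof. by rewrite -(rank_setU_cl (subxx (cl X))) (setUidPr (sub_cl X)). Qed.

Lemma cl_flat X : is_flat (cl X).
Proof.
rewrite /is_flat eqEsubset sub_cl andbT; apply/subsetP => x.
rewrite !inE rank_cl => /eqP rx; rewrite eqn_leq -{1}rx.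
by rewrite !rank_mono ?subsetUr ?setUS ?sub_cl.
Qed.

Lemma setI_flat X Y : is_flat X -> is_flat Y -> is_flat (X :&: Y).
Proof.
move=> /eqP fX /eqP fY; rewrite /is_flat eqEsubset sub_cl andbT subsetI.
have := clS (subsetIl X Y); have := clS (subsetIr X Y).
by rewrite fX fY => -> ->.
Qed.

Lemma setT_flat : is_flat setT.
Proof. by rewrite /is_flat eqEsubset sub_cl subsetT. Qed.

Record flat := Flat { fset :> {set E}; flatP : is_flat fset }.

HB.instance Definition _ := [isSub for fset].
HB.instance Definition _ := [Finite of flat by <:].

Definition fle (F G : flat) : bool := F \subset G.
Definition fmeet (F G : flat) : flat := Flat (setI_flat (flatP F) (flatP G)).
Definition fjoin (F G : flat) : flat := Flat (cl_flat (F :|: G)).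
Definition fbot : flat := Flat (cl_flat set0).
Definition ftop : flat := Flat setT_flat.

Lemma fle_refl : reflexive fle. Proof. by move=> F; apply: subxx. Qed.
Lemma fle_anti : antisymmetric fle.
Proof. by move=> F G sFG; apply: val_inj; apply/eqP; rewrite eqEsubset. Qed.
Lemma fle_trans : transitive fle.
Proof. by move=> F G H; apply: subset_trans. Qed.
Lemma cl_sub_flat X (F : flat) : (cl X \subset F) = (X \subset F).
Proof.
apply/idP/idP => [|/clS]; first by apply: subset_trans; apply: sub_cl.
by rewrite (eqP (flatP F)).
Qed.
Lemma fmeetP F G H : fle F (fmeet G H) = fle F G && fle F H.
Proof. exact: subsetI. Qed.
Lemma fjoinP F G H : fle (fjoin F G) H = fle F H && fle G H.
Proof. by rewrite /fle /= cl_sub_flat subUset. Qed.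
Lemma fle0 F : fle fbot F.
Proof. by rewrite /fle /= cl_sub_flat sub0set. Qed.
Lemma fle1 F : fle F ftop. Proof. exact: subsetT. Qed.

End Flats.

Fact flat_display : Order.disp_t. Proof. exact: Order.Disp tt tt. Qed.

HB.instance Definition _ (E : finType) (M : matroid E) :=
  Order.Le_isPOrder.Build flat_display (flat M)
    (@fle_refl E M) (@fle_anti E M) (@fle_trans E M).
HB.instance Definition _ (E : finType) (M : matroid E) :=
  Order.POrder_MeetJoin_isLattice.Build flat_display (flat M)
    (@fmeetP E M) (@fjoinP E M).
HB.instance Definition _ (E : finType) (M : matroid E) :=
  Order.hasBottom.Build flat_display (flat M) (@fle0 E M).
HB.instance Definition _ (E : finType) (M : matroid E) :=
  Order.hasTop.Build flat_display (flat M) (@fle1 E M).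

Lemma flat_leE (E : finType) (M : matroid E) (F G : flat M) :
  (F <= G)%O = (F \subset G).
Proof. by []. Qed.
Lemma flat_meetE (E : finType) (M : matroid E) (F G : flat M) :
  (F `&` G)%O = F :&: G :> {set E}.
Proof. by []. Qed.
Lemma flat_joinE (E : finType) (M : matroid E) (F G : flat M) :
  (F `|` G)%O = cl M (F :|: G) :> {set E}.
Proof. by []. Qed.

Definition pseudomodular (E : finType) (M : matroid E) : Prop :=
  pseudomodular_lattice (flat M).

Lemma flat_grading (E : finType) (M : matroid E) :
  is_grading (fun F : flat M => rank M F).
Proof.
split=> [|F G]; first by rewrite /= rank_cl; apply/eqP; rewrite -leqn0 -(cards0 E) rank_le_card.
case/andP=> ltFG /forallP noH.
have sFG : F \subset G by exact: (ltW ltFG).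
have [x xG xF] : exists2 x, x \in fset G & x \notin fset F.
  apply/subsetPn; apply: contraTN ltFG => sGF.
  by apply/negP => /lt_geF; rewrite flat_leE sGF.
have rx : rank M (x |: F) = (rank M F).+1.
  have : x \notin cl M F by rewrite (eqP (flatP F)).
  rewrite inE => /eqP rx; have := rank_mono M (subsetUr [set x] F).
  have := rank_submod M [set x] F; have := rank_le_card M [set x].
  by rewrite cards1; lia.
pose H := Flat (cl_flat M (x |: F)).
have FH : (F < H)%O.
  rewrite lt_neqAle; apply/andP; split.
    apply: contraNneq xF => ->; apply: (subsetP (sub_cl _ _)).
    exact: setU11.
  by apply: subset_trans (sub_cl _ _); apply: subsetUr.
have HG : (H <= G)%O by rewrite flat_leE /= cl_sub_flat subUset sub1set xG.
have := noH H; rewrite FH /= lt_neqAle HG andbT negbK => /eqP <-.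
by rewrite /= rank_cl.
Qed.

Lemma flat_atomistic (E : finType) (M : matroid E) : atomistic (flat M).
Proof.
move=> F; exists [set G : flat M | atom G && (G <= F)%O].
  by move=> G; rewrite inE => /andP[].
apply/le_anti/andP; split; last first.
  by apply/joinsP => G; rewrite inE => /andP[].
rewrite flat_leE; apply/subsetP => x xF; set J := (X in _ \in fset X).
have [xl|xl] := boolP (x \in fset (\bot%O : flat M)).
  by apply: (subsetP (_ : (\bot <= J)%O)) xl; apply: le0x.
pose G := Flat (cl_flat M [set x]).
have xG : x \in fset G by apply: (subsetP (sub_cl _ _)); rewrite set11.
suff /subsetP : (G <= J)%O by apply.
apply: joins_sup; rewrite inE flat_leE cl_sub_flat sub1set xF andbT.
have G0 : (\bot < G)%O by rewrite lt0x; apply: contraNneq xl => <-.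
rewrite /atom /covered G0; apply/forallP => H; apply/negP => /andP[].
rewrite lt0x => Hn0 HG.
have [y yH ybot] : exists2 y, y \in fset H & y \notin fset (\bot%O : flat M).
  apply/subsetPn; apply: contra Hn0 => sH0.
  by rewrite -lex0 flat_leE.
have r0 : rank M set0 = 0 by apply/eqP; rewrite -leqn0 -(cards0 E) rank_le_card.
have ry : 0 < rank M [set y].
  by move: ybot; rewrite inE setU0 r0 -lt0n.
have yG : y \in fset G by apply: (subsetP (ltW HG)).
have xH : x \in fset H.
  have : x \in cl M [set y].
    move: yG; rewrite !inE setUC => /eqP ryx; rewrite ryx.
    have := rank_mono M (subsetUr [set x] [set y]); rewrite ryx.
    by have := rank_le_card M [set x]; rewrite cards1; lia.
  by apply: subsetP; rewrite cl_sub_flat sub1set.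
by move/lt_geF: HG; rewrite flat_leE cl_sub_flat sub1set xH.
Qed.

Lemma flat_semimodular (E : finType) (M : matroid E) : semimodular (flat M).
Proof.
exists (fun F : flat M => rank M F); first exact: flat_grading.
by move=> F G; rewrite flat_joinE rank_cl; apply: rank_submod.
Qed.

Lemma flat_geometric (E : finType) (M : matroid E) : geometric (flat M).
Proof.
split; [by exists (fun F : flat M => rank M F); apply: flat_grading | exact: flat_atomistic |].
exact: flat_semimodular.
Qed.

Section FoldCircuits.
Variables (E : finType) (M : matroid E).
Implicit Types D B : {set E}.

Definition cyclic_set D : bool := [forall e in D, rank M (D :\ e) == rank M D].

Definition fold_circuit (k : nat) D : bool :=
  cyclic_set D && ((rank M D)%:Z == #|D|%:Z - k%:Z)%R.

(* Meaningful only for k > 0, because of k.-1. *)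
Definition principal_partition (k : nat) D : {set {set E}} :=
  [set D :\: B | B in [set B : {set E} | (B \subset D) && fold_circuit k.-1 B]].

Definition balanced (k : nat) D : Prop :=
  let P := principal_partition k D in
  ((rank M (\bigcap_(A in P) cl M (D :\: A)))%:Z = #|P|%:Z - k%:Z)%R.

Definition fold_circuit_property (k : nat) : Prop :=
  forall D, fold_circuit k D -> balanced k D.

End FoldCircuits.

(* Main.v *)
Require Import Defs.
From mathcomp Require Import all_boot all_order all_algebra.
From mathcomp Require Import zify.

(** Write [B_i = D \ A_i] and [F_i = cl B_i].  Distinct [(k-1)]-fold circuits
    [B_i], [B_j] cover [D], so the [A_i] partition [D].  By induction on a
    nonempty set [K] of indices,
      [r (\bigcap_(i in K) F_i) = r D - \sum_(i in K) (|A_i| - 1)],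
    which for the full index set is [l - k].  The cases [|K| <= 2] hold in every
    matroid.  If [K] contains distinct [1], [2], [3], put
    [X = \bigcap_(i in K - 1) F_i], [Y = \bigcap_(i in K - 2) F_i], and let [Z]
    be [A_3] minus one element.  Since [X] and [Y] lie in [F_3] and [Z] is free
    over [F_3], [Z] has the same rank [|Z|] over [X], [Y] and [X v Y]; by
    induction, joining [Z] to [X] or [Y] amounts to dropping the index [3].
    Pseudomodularity then turns the rank of [\bigcap_(i in K - 3) F_i] into that
    of [X ^ Y], which is [\bigcap_(i in K) F_i]. *)

Set Implicit Arguments.
Unset Strict Implicit.
Unset Printing Implicit Defensive.

(** * Rank, closure and nullity in a matroid *)

Section RankFacts.
Variables (E : finType) (M : matroid E).
Implicit Types X Y Z F G D : {set E}.

Lemma rank_setU_le X Z : rank M (X :|: Z) <= rank M X + #|Z|.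
Proof.
by have := rank_submod M X Z; have := rank_le_card M Z; lia.
Qed.

Lemma rank_setU_clr X Z : rank M (X :|: cl M Z) = rank M (X :|: Z).
Proof.
have sZ : X :|: cl M Z \subset cl M (X :|: Z).
  by rewrite subUset (subset_trans (subsetUl X Z) (sub_cl _ _)) clS ?subsetUr.
apply/eqP; rewrite eqn_leq -{1}(rank_cl M (X :|: Z)) rank_mono //=.
by rewrite rank_mono // setUS ?sub_cl.
Qed.

Lemma rank_setU_cll X Z : rank M (cl M X :|: Z) = rank M (X :|: Z).
Proof. by rewrite setUC rank_setU_clr setUC. Qed.

Lemma cl_eq_flat X G : X \subset G -> is_flat M G -> rank M X = rank M G ->
  cl M X = G.
Proof.
move=> sXG /eqP fG rXG; apply/eqP; rewrite eqEsubset -{1}fG clS //=.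
apply/subsetP => g gG; rewrite inE eqn_leq (rank_mono M (subsetUr _ X)) andbT rXG.
by rewrite rank_mono // subUset sub1set gG.
Qed.

Lemma bigcap_flat (I : finType) (P : {set I}) (F : I -> {set E}) :
  (forall i, is_flat M (F i)) -> is_flat M (\bigcap_(i in P) F i).
Proof.
by move=> fF; elim/big_ind: _ => // [|X Y]; [apply: setT_flat|apply: setI_flat].
Qed.

(** By submodularity the increment from adding [Z] can only grow when [F] shrinks to [X], and it
    never exceeds [#|Z|]. *)
Lemma free_over_sub X F Z : X \subset F ->
  rank M (F :|: Z) = rank M F + #|Z| -> rank M (X :|: Z) = rank M X + #|Z|.
Proof.
move=> sXF rFZ; apply/eqP; rewrite eqn_leq rank_setU_le /=.
have := rank_submod M F (X :|: Z).
rewrite setUA (setUidPl sXF) rFZ.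
have : rank M X <= rank M (F :&: (X :|: Z)).
  by apply: rank_mono; rewrite subsetI sXF subsetUl.
by lia.
Qed.

(** Lattice pseudomodularity for the flats [X], [Y] and [cl M Z], restated for an arbitrary set [Z];
    the abstract grading is the rank by [grading_unique]. *)
Lemma pseudomodular_rank X Y Z z : pseudomodular M ->
  is_flat M X -> is_flat M Y ->
  rank M (X :|: Z) = rank M X + z -> rank M (Y :|: Z) = rank M Y + z ->
  rank M (X :|: Y :|: Z) = rank M (X :|: Y) + z ->
  rank M (cl M (X :|: Z) :&: cl M (Y :|: Z)) = rank M (X :&: Y) + z.
Proof.
move=> [_ [rho rhoP pm]] fX fY rX rY rXY.
have rhoE := grading_unique rhoP (flat_grading M).
have clU W : cl M (W :|: cl M Z) = cl M (W :|: Z).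
  apply/esym/cl_eq_flat; rewrite ?cl_flat ?rank_cl ?rank_setU_clr //.
  by apply: subset_trans (sub_cl _ _); rewrite setUS ?sub_cl.
move: (pm (Flat fX) (Flat fY) (Flat (cl_flat M Z))).
rewrite !rhoE !flat_joinE flat_meetE flat_meetE !flat_joinE /=.
rewrite !clU !rank_cl rank_setU_cll rX rY rXY.
by lia.
Qed.

Lemma cyclic_setP D e : cyclic_set M D -> e \in D -> rank M (D :\ e) = rank M D.
Proof. by move=> /forall_inP cD eD; apply/eqP/cD. Qed.

Lemma fold_circuitP k D :
  reflect (cyclic_set M D /\ rank M D + k = #|D|) (fold_circuit M k D).
Proof.
apply: (iffP andP) => -[cD H]; split=> //; first by move/eqP: H; lia.
by apply/eqP; lia.
Qed.

(** Call [#|X|] minus the rank of [X] its nullity. Deleting a first element [e] outside [X] from the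
    cyclic set [D] keeps the rank, so the nullity drops; further deletions never raise it. *)
Lemma nullity_cyclic_proper D X : cyclic_set M D -> X \proper D ->
  rank M D + #|X| < #|D| + rank M X.
Proof.
move=> cD /properP[sXD [e eD eX]].
have sX : X \subset D :\ e by rewrite subsetD1 sXD.
have := rank_setU_le X ((D :\ e) :\: X).
rewrite setDE setUIr setUCr setIT (setUidPr sX) -setDE cyclic_setP //.
by rewrite cardsDS //; have := subset_leq_card sX; rewrite (cardsD1 e D) eD; lia.
Qed.

(** Take a smallest subset with the nullity of [X]: an element whose deletion lowered the rank could
    be removed without changing the nullity. *)
Lemma cyclic_subset_nullity X : exists B : {set E}, [/\ B \subset X, cyclic_set M B &
  rank M B + #|X| = #|B| + rank M X].
Proof.
pose Q (B : {set E}) := (B \subset X) && (rank M B + #|X| == #|B| + rank M X).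
have QX : Q X by rewrite /Q subxx addnC eqxx.
have [B /andP[sB /eqP rB] Bmin] := @arg_minnP _ X Q (fun B : {set E} => #|B|) QX.
exists B; split=> //; apply/forall_inP => e eB.
have cB : #|B| = #|B :\ e|.+1 by rewrite (cardsD1 e B) eB.
have := Bmin (B :\ e); rewrite /Q (subset_trans (subsetDl _ _) sB) /=.
have := rank_mono M (subsetDl B [set e]).
have := rank_setU_le (B :\ e) [set e]; rewrite setUC setD1K // cards1.
by lia.
Qed.

End RankFacts.

(** * The principal partition of a [k]-fold circuit *)

Section PrincipalPartition.
Variables (E : finType) (M : matroid E) (k : nat) (D : {set E}).
Hypotheses (k_gt0 : 0 < k) (fcD : fold_circuit M k D).
Implicit Types (A B : {set E}) (K : {set {set E}}).
Let P := principal_partition M k D.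
Let F A := cl M (D :\: A).
Let S (K : {set {set E}}) := \bigcap_(A in K) F A.

Lemma fold_circuit_cyclic : cyclic_set M D.
Proof. by case/fold_circuitP: fcD. Qed.

Lemma fold_circuit_nullity : rank M D + k = #|D|.
Proof. by case/fold_circuitP: fcD. Qed.

Lemma principal_partP A : A \in P ->
  [/\ A \subset D, cyclic_set M (D :\: A) &
      rank M (D :\: A) + #|A| = (rank M D).+1].
Proof.
move=> /imsetP[B]; rewrite inE => /andP[sB /fold_circuitP[cB nB]] ->.
rewrite subsetDl setDDr setDv set0U (setIidPr sB); split=> //.
(* Since [0 < k], the nullity [k.-1] of [B] is exactly one less than that of [D]. *)
have := fold_circuit_nullity; rewrite cardsDS //.
by have := subset_leq_card sB; lia.
Qed.

Lemma principal_part_neq0 A : A \in P -> A != set0.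
Proof.
move=> /principal_partP[_ _]; apply: contra_eq_neq => ->.
by rewrite setD0 cards0; lia.
Qed.

(** Up to symmetry [D :\: (A :|: B)] is a proper subset of the cyclic set [D :\: B], so its nullity
    is at most [k - 2]. *)
Lemma principal_part_pair A B : A \in P -> B \in P -> A != B ->
  (rank M D).+2 <= rank M (D :\: (A :|: B)) + #|A :|: B|.
Proof.
move=> AP BP; wlog /subsetPn[x xA xB] : A B AP BP / ~~ (A \subset B) => [H|_].
  rewrite eqEsubset negb_and => /orP[] nAB.
    by apply: H => //; apply: contraNneq nAB => ->.
  by rewrite setUC; apply: H => //; apply: contraNneq nAB => ->.
have [sA _ _] := principal_partP AP; have [sB cB rB] := principal_partP BP.
have sAB : A :|: B \subset D by rewrite subUset sA.
have pr : D :\: (A :|: B) \proper D :\: B.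
  apply/properP; split; first by rewrite setDS ?subsetUr.
  by exists x; rewrite !inE ?xA ?xB ?(subsetP sA).
have := nullity_cyclic_proper cB pr; rewrite !cardsDS //.
by have := subset_leq_card sAB; have := subset_leq_card sB; lia.
Qed.

(** Nullity is supermodular. If [A] met [B], the union and intersection of [D :\: A] and [D :\: B]
    would have nullities at most [k - 1] and [k - 2], against a total of at least [2(k - 1)]. *)
Lemma principal_part_disjoint A B : A \in P -> B \in P -> A != B ->
  [disjoint A & B].
Proof.
move=> AP BP neAB; rewrite -setI_eq0; apply/negPn/negP => /set0Pn[x xAB].
have [sA _ rA] := principal_partP AP; have [sB _ rB] := principal_partP BP.
have rAB := principal_part_pair AP BP neAB.
have sI : A :&: B \subset D by rewrite subIset ?sA.
have pr : D :\: (A :&: B) \proper D.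
  apply/properP; split; first exact: subsetDl.
  by exists x; [apply: (subsetP sI) | rewrite inE xAB].
have := nullity_cyclic_proper fold_circuit_cyclic pr.
have := rank_submod M (D :\: A) (D :\: B).
rewrite -setDIr -setDUr cardsDS //.
by have := subset_leq_card sI; have := cardsUI A B; lia.
Qed.

Lemma cover_principal_partition : cover P = D.
Proof.
apply/eqP; rewrite eqEsubset; apply/andP; split.
  by apply/bigcupsP => A /principal_partP[].
apply/subsetP => e eD.
(* [D :\ e] has nullity [k - 1], so this [B] is a [(k-1)]-fold circuit avoiding [e]. *)
have [B [sB cB rB]] := cyclic_subset_nullity M (D :\ e).
have sBD : B \subset D := subset_trans sB (subsetDl _ _).
apply/bigcupP; exists (D :\: B); last first.
  by rewrite inE eD andbT; apply/negP => /(subsetP sB); rewrite !inE eqxx.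
apply/imsetP; exists B => //; rewrite inE sBD; apply/fold_circuitP; split=> //.
move: rB; rewrite (cyclic_setP fold_circuit_cyclic eD).
by have := fold_circuit_nullity; rewrite (cardsD1 e D) eD; lia.
Qed.

Lemma trivIset_principal_partition : trivIset P.
Proof. by apply/trivIsetP => A B; apply: principal_part_disjoint. Qed.

(** * The flats [F A] and their intersections *)

Lemma principal_part_subF A B : A \in P -> B \in P -> A != B -> A \subset F B.
Proof.
move=> AP BP neAB; apply: subset_trans (sub_cl _ _).
have [sA _ _] := principal_partP AP.
by rewrite subsetD sA principal_part_disjoint.
Qed.

Lemma flat_bigcapF K : is_flat M (S K).
Proof. by apply: bigcap_flat => A; apply: cl_flat. Qed.

Lemma sum_card_D1 K A : A \in K ->
  \sum_(B in K) #|B| = #|A| + \sum_(B in K :\ A) #|B|.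
Proof. by move=> AK; rewrite (big_setD1 A). Qed.

Lemma bigcapF_D1 K A B : A != B -> S (K :\ A) :&: S (K :\ B) = S K.
Proof.
move=> neAB; rewrite /S -bigcap_setU -setDIr.
suff -> : [set A] :&: [set B] = set0 by rewrite setD0.
by apply/eqP; rewrite setI_eq0 disjoints1 inE.
Qed.

Lemma free_over_F A e : A \in P -> e \in A ->
  rank M (F A :|: A :\ e) = rank M (F A) + #|A :\ e|.
Proof.
move=> AP eA; apply/eqP; rewrite eqn_leq rank_setU_le /=.
have [sA _ rA] := principal_partP AP.
have sD : D :\ e \subset F A :|: A :\ e.
  apply/subsetP => x; rewrite !in_setU !in_setD1 => /andP[-> xD] /=.
  have [_|xA] := boolP (x \in A); first by rewrite orbT.
  by rewrite (subsetP (sub_cl _ _)) // inE xA.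
have := rank_mono M sD.
rewrite (cyclic_setP fold_circuit_cyclic (subsetP sA _ eA)) rank_cl.
by move: rA; rewrite (cardsD1 e A) eA; lia.
Qed.

(** The lower bound comes from [D :\: (A :|: B)], which lies in both flats; the upper bound from
    submodularity, as the two flats cover [D]. *)
Lemma rank_bigcapF2 A B : A \in P -> B \in P -> A != B ->
  rank M (F A :&: F B) + (#|A| + #|B|) = (rank M D).+2.
Proof.
move=> AP BP neAB.
have [sA _ rA] := principal_partP AP; have [sB _ rB] := principal_partP BP.
have dAB := principal_part_disjoint AP BP neAB.
have cAB : #|A :|: B| = #|A| + #|B| by apply/eqP; rewrite -leq_card_setU in dAB *.
have := principal_part_pair AP BP neAB; rewrite cAB.
have : rank M (D :\: (A :|: B)) <= rank M (F A :&: F B).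
  apply: rank_mono; rewrite setDUr subsetI.
  by rewrite !(subset_trans _ (sub_cl _ _)) ?subsetIl ?subsetIr.
have : rank M D <= rank M (F A :|: F B).
  apply: rank_mono; apply: subset_trans (setUSS (sub_cl _ _) (sub_cl _ _)).
  by rewrite -setDIr (disjoint_setI0 dAB) setD0.
have := rank_submod M (F A) (F B); rewrite !rank_cl.
by lia.
Qed.

(** By disjointness [A] lies in every other [F B], which gives one inclusion; adding [A :\ e] raises
    the rank by [#|A| - 1], just what dropping [A] from [K] does. *)
Lemma joinF_bigcapF K A e : K \subset P -> A \in K -> e \in A ->
  rank M (S K) + \sum_(B in K) #|B| = rank M D + #|K| ->
  rank M (S (K :\ A)) + \sum_(B in K :\ A) #|B| = rank M D + #|K :\ A| ->
  cl M (S K :|: A :\ e) = S (K :\ A).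
Proof.
move=> sKP AK eA rK rKA; have AP := subsetP sKP _ AK.
have sSF : S K \subset F A by apply: bigcap_inf.
apply: cl_eq_flat; rewrite ?flat_bigcapF //.
  rewrite subUset; apply/andP; split.
    by apply/bigcapsP => B /setD1P[_ BK]; apply: bigcap_inf.
  apply/bigcapsP => B /setD1P[neBA BK].
  apply: subset_trans (subsetDl _ _) _.
  by apply: principal_part_subF; rewrite ?(subsetP sKP) // eq_sym.
rewrite (free_over_sub sSF (free_over_F AP eA)).
(* Elaborating [{set {set E}}] inserts [reverse_coercion], which hides equal
   atoms from [lia]. *)
move: rK rKA; rewrite (sum_card_D1 AK) (cardsD1 A K) AK.
by rewrite (cardsD1 e A) eA /reverse_coercion; lia.
Qed.

(** * The induction, using pseudomodularity *)

Hypothesis pmM : pseudomodular M.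

Lemma rank_bigcapF K : K \subset P -> K != set0 ->
  rank M (S K) + \sum_(A in K) #|A| = rank M D + #|K|.
Proof.
have [n] := ubnP #|K|; elim: n K => // n IH K ltn sKP /set0Pn[A3 A3K].
have [K3|/set0Pn[A1 A1K']] := eqVneq (K :\ A3) set0.
  have -> : K = [set A3] by rewrite -(setD1K A3K) K3 setU0.
  have [_ _ rA] := principal_partP (subsetP sKP _ A3K).
  by rewrite /S !big_set1 cards1 rank_cl; lia.
have [ne13 A1K] := setD1P A1K'.
have [K13|/set0Pn[A2 A2K']] := eqVneq (K :\ A3 :\ A1) set0.
  have -> : K = [set A3; A1] by rewrite -(setD1K A3K) -(setD1K A1K') K13 setU0.
  have ne31 : A3 != A1 by rewrite eq_sym.
  rewrite /S !big_setU1 ?inE //= !big_set1 cards2 ne31 rank_bigcapF2 ?addn2 //.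
    exact: subsetP A3K.
  exact: subsetP A1K.
have [ne21 A2K3] := setD1P A2K'; have [ne23 A2K] := setD1P A2K3.
(* In [IHD] and [IHDD], [C] only witnesses that the smaller index set is nonempty. *)
have IHD A C : A \in K -> C \in K :\ A ->
    rank M (S (K :\ A)) + \sum_(B in K :\ A) #|B| = rank M D + #|K :\ A|.
  move=> AK CK; apply: IH; last by apply/set0Pn; exists C.
    by move: ltn; rewrite (cardsD1 A K) AK /reverse_coercion; lia.
  exact: subset_trans (subsetDl _ _) sKP.
have IHDD A B C : A \in K -> C \in K :\ A :\ B ->
    rank M (S (K :\ A :\ B)) + \sum_(G in K :\ A :\ B) #|G|
    = rank M D + #|K :\ A :\ B|.
  move=> AK CK; apply: IH; last by apply/set0Pn; exists C.
    have := subset_leq_card (subsetDl (K :\ A) [set B]).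
    by move: ltn; rewrite (cardsD1 A K) AK /reverse_coercion; lia.
  by do 2!apply: subset_trans (subsetDl _ _) _.
have A3P := subsetP sKP _ A3K; have /set0Pn[e eA] := principal_part_neq0 A3P.
have free := free_over_F A3P eA.
have sSF A : A != A3 -> S (K :\ A) \subset F A3.
  by move=> neA; apply: bigcap_inf; rewrite in_setD1 eq_sym neA.
have join3 A C : A \in K -> A != A3 -> C \in K :\ A :\ A3 ->
    cl M (S (K :\ A) :|: A3 :\ e) = S (K :\ A3 :\ A).
  move=> AK neA CK; have A3KA : A3 \in K :\ A by rewrite in_setD1 eq_sym neA.
  rewrite (setDDl K) (setUC [set A3]) -setDDl; apply: joinF_bigcapF => //.
  - exact: subset_trans (subsetDl _ _) sKP.
  - exact: IHD A3KA.
  - exact: IHDD CK.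
have := pseudomodular_rank pmM (flat_bigcapF (K :\ A1)) (flat_bigcapF (K :\ A2))
  (free_over_sub (sSF _ ne13) free) (free_over_sub (sSF _ ne23) free)
  (free_over_sub _ free).
rewrite subUset !sSF // => /(_ isT).
rewrite (join3 A1 A2) ?(join3 A2 A1) ?in_setD1 ?ne21 ?ne23 ?ne13 1?eq_sym ?ne21 //.
(* The two joins meet in [S (K :\ A3)], while [S (K :\ A1)] and [S (K :\ A2)] meet in [S K]. *)
rewrite !bigcapF_D1 1?eq_sym //.
have := IHD _ _ A3K A1K'.
rewrite (sum_card_D1 A3K) (cardsD1 A3 K) A3K (cardsD1 e A3) eA /reverse_coercion.
by lia.
Qed.

Lemma fold_circuit_balanced : balanced M k D.
Proof.
have P0 : P != set0.
  apply/eqP => P0; have := cover_principal_partition.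
  rewrite P0 /cover big_set0 => D0; have := fold_circuit_nullity.
  by rewrite -D0 cards0; lia.
(* For [K = P] the parts sum to [#|D|], which is [rank M D + k]. *)
have := rank_bigcapF (subxx P) P0.
rewrite (eqP trivIset_principal_partition) cover_principal_partition.
by rewrite /balanced -/P -/(S P); have := fold_circuit_nullity; lia.
Qed.

End PrincipalPartition.

Theorem mainTheorem4 (E : finType) (M : matroid E) (hM : pseudomodular M)
  (k : nat) (hk : 1 <= k) : fold_circuit_property M k.
Proof. by move=> D fcD; apply: fold_circuit_balanced. Qed.
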